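(* Let $T$ be a normal operator on a complex Hilbert space $H$ with $$\sigma(T)\subseteq\Pi(\beta_T)\cup-\Pi(-\alpha_T)$$ for some real $\alpha_T<\beta_T$. Let $0\le p<1/2$, $c>0$, and let $A$ be a linear operator on $H$ with $\mathcal D(T)\subseteq\mathcal D(A)$ and $\|Ax\|\le c\|x\|^{1-p}\|Tx\|^p$ for all $x\in\mathcal D(T)$. Let $\zeta_T=\max\{|\beta_T|,|\alpha_T|\}$ and let $\nu_0\ge1/2$ be such that $$\frac{c\Big(\sqrt{\widehat\nu-\tfrac14}+\sqrt{\zeta_T^2+\widehat\nu^2}\Big)^p}{\sqrt{\widehat\nu-\tfrac14}}<1\qquad\text{for all }\widehat\nu>\nu_0.$$ If there exists $M>0$ such that $$\frac{c\Big(M+\sqrt{\zeta_T^2+\nu_0^2}\Big)^p}{M}<1\quad\text{and}\quad 2M<\beta_T-\alpha_T,$$ then $$\{z\in\mathbb C:\alpha_T+M<\operatorname{Re} z<\beta_T-M\}\subseteq\rho(T+A).$$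
   Context: $\mathcal D(S)$ denotes the domain of an operator $S$. A closed densely defined operator $T$ on $H$ is normal if $TT^*=T^*T$. The operator $T+A$ has domain $\mathcal D(T)$. The resolvent set $\rho(S)$ is the set of $z\in\mathbb C$ such that $S-z:\mathcal D(S)\to H$ is bijective with bounded inverse; $\sigma(S)=\mathbb C\setminus\rho(S)$. For $\lambda\in\mathbb R$, $\Pi(\lambda)=\{z\in\mathbb C:\operatorname{Re} z\ge\lambda,\ |\operatorname{Im} z|\le(\operatorname{Re} z-\lambda)^2\}$, and $-\Pi(-\alpha_T)=\{-z:z\in\Pi(-\alpha_T)\}$. The convention $0^0=1$ is used. *)

(* Defs.v *)
From HB Require Import structures.
From mathcomp Require Import all_boot all_order all_algebra.
From mathcomp Require Import sesquilinear complex.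
From mathcomp Require Import all_classical all_reals all_analysis.

Set Implicit Arguments.
Unset Strict Implicit.
Unset Printing Implicit Defensive.

Import Order.TTheory GRing.Theory Num.Theory.
Import numFieldNormedType.Exports.

Local Open Scope classical_set_scope.
Local Open Scope ring_scope.

(* A complex Hilbert space is a [completeNormedModType R[i]] together with a
   form [dot : {dot H for Num.conj}] (linear in the first argument, antilinear
   in the second, positive definite) such that [dot x x = `|x| ^+ 2]. *)

(* The library norm on a normed module over [R[i]] takes its values in [R[i]]
   (nonnegative reals, hence equal to their real part). *)
Definition hnorm (R : realType) (H : normedModType R[i]) (x : H) : R :=
  complex.Re `|x|.

(* The values of [op_fun] outside [op_dom] are irrelevant. Linearity is the
   separate predicate [linear_operator], so that the adjoint can be formed
   without a proof that the operator is linear and densely defined. *)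
Record operator (R : realType) (H : normedModType R[i]) := Operator {
  op_dom : set H ;
  op_fun :> H -> H }.

Section UnboundedOperators.
Context (R : realType) (H : normedModType R[i]).
Implicit Types S T A : operator H.

Definition linear_operator S : Prop :=
  [/\ op_dom S 0,
      forall (a : R[i]) (x y : H),
        op_dom S x -> op_dom S y -> op_dom S (a *: x + y) &
      forall (a : R[i]) (x y : H),
        op_dom S x -> op_dom S y -> S (a *: x + y) = a *: S x + S y].

Definition op_eq S T : Prop :=
  op_dom S = op_dom T /\ (forall x, op_dom S x -> S x = T x).

Definition op_comp S T : operator H :=
  Operator [set x | op_dom T x /\ op_dom S (T x)] (fun x => S (T x)).

(* The domain is that of [T]: this is only used when it is included in the
   domain of [A]. *)
Definition op_perturb T A : operator H :=
  Operator (op_dom T) (fun x => T x + A x).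

Definition op_shift S (z : R[i]) : operator H :=
  Operator (op_dom S) (fun x => S x - z *: x).

Definition densely_defined S : Prop := dense (op_dom S).

Definition closed_operator S : Prop :=
  closed [set xy : H * H | op_dom S xy.1 /\ xy.2 = S xy.1].

(* [y] is in the domain of the adjoint iff some [w] satisfies
   [dot (S x) y = dot x w] for all [x] in the domain of [S]; such a [w] is
   unique when [S] is densely defined, and [get] picks it. *)
Definition adjoint (dot : {dot H for Num.conj}) S : operator H :=
  let is_image (y w : H) :=
    forall x, op_dom S x -> dot (S x) y = dot x w in
  Operator [set y | exists w, is_image y w]
           (fun y => get [set w | is_image y w]).

Definition normal_operator (dot : {dot H for Num.conj}) T : Prop :=
  [/\ linear_operator T, densely_defined T, closed_operator T &
      op_eq (op_comp T (adjoint dot T)) (op_comp (adjoint dot T) T)].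

Definition bounded_map (f : H -> H) : Prop :=
  exists K : R, forall x, hnorm (f x) <= K * hnorm x.

Definition resolvent_set S : set R[i] :=
  [set z | set_bij (op_dom S) [set: H] (op_shift S z) /\
           exists2 G : H -> H,
             forall x, op_dom S x -> G (op_shift S z x) = x &
             bounded_map G].

Definition spectrum S : set R[i] := ~` resolvent_set S.

End UnboundedOperators.

Definition parabolic_region (R : realType) (lambda : R) : set R[i] :=
  [set z | lambda <= complex.Re z /\
           `|complex.Im z| <= (complex.Re z - lambda) ^+ 2].

(* Main.v *)
Require Import Defs.
From HB Require Import structures.
From mathcomp Require Import all_boot all_order all_algebra.
From mathcomp Require Import sesquilinear complex.
From mathcomp Require Import all_classical all_reals all_analysis.
From mathcomp Require Import ring lra.
Set Implicit Arguments.
Unset Strict Implicit.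
Unset Printing Implicit Defensive.
Import Order.TTheory GRing.Theory Num.Theory.
Import numFieldNormedType.Exports.
Local Open Scope classical_set_scope.
Local Open Scope ring_scope.

(** Write S = T - z for a point z of the strip and let d > 0 be such that the
    open disc of radius d around z avoids the spectrum of T.  For a normal
    operator the resolvent is as small as the spectrum permits, so that
    d |x| <= |S x| on the domain of T.  Then |T x| <= (1 + |z|/d) |S x|, and the
    interpolation inequality for A becomes |A x| <= q |S x| with
    q = c (d + |z|)^p / d.  As soon as q < 1 the operator S + A is a small
    relative perturbation of the bijection S, hence a bijection with bounded
    inverse (resolvent_perturb).

    Two radii d are used.  If |Im z| <= nu0, take d = M, the horizontal distance
    to the two parabolic regions (strip_disc).  If |Im z| > nu0, take
    d = sqrt (|Im z| - 1/4), a lower bound for the distance from a point above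
    or below a parabola to that parabola (parabola_disc).  In both cases
    |Re z| <= zetaT bounds |z|, and the two smallness hypotheses give q < 1.

    The core is the inequality d |x| <= |S x| (normal_bounded_below_disc).  It
    is obtained without a spectral theorem, in two steps.

    Normality yields Re <S v, x> <= |v| |S x| for v and x in the domain
    (normal_rdot_shift_le): formally this is |S' x| = |S x| for the adjoint S'.
    For x in the domain of T'T this equality is a computation; a general x is
    approximated by the minimiser u of |x - u|^2 + e^2 |T u|^2, which lies in
    the domain of T'T by the Euler equation.  With v = N (N y) and x = N y, where
    N is the inverse of S, it reads |N y|^2 <= |y| |N (N y)|, and therefore
    |N y|^n <= |y|^(n-1) |N^n y| for all n (log_convex_iter).

    It remains to bound N^n, for large n = 2^k, by using that 1 - w N is
    invertible for |w| <= r < d (paranormal_bound).  This is the elementary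
    proof of the spectral radius formula by roots of unity: the inverse of
    1 - w^n N^n is the mean of the inverses of 1 - zeta w N over the n-th roots
    of unity zeta, so it inherits, uniformly in n, the bound and the Lipschitz
    constant in w of the inverse of 1 - w N.  If s |N| < 1 the inverse of
    1 - s^n N^n tends to the identity; by the uniform Lipschitz bound the
    inverse of 1 - t^n N^n stays near the identity for t slightly larger than
    s, which makes t^n |N^n| small and gives t |N| <= 1.  Steps of a fixed length
    lead from t = 0 to t = r.  The uniform bounds come from the compactness of
    the closed disc (uniform_bounded_below). *)

(** * Real-valued modulus, norm and inner product *)

(** The norm of R[i] takes its values in R[i]; estimates are carried out in the
    totally ordered field R, so the modulus is read there. *)
Definition cmod {R : realType} (z : R[i]) : R := complex.Re `|z|.

Section ComplexModulus.
Context {R : realType}.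
Implicit Types z w : R[i].

Lemma norm_cmod z : `|z| = (cmod z)%:C%C.
Proof. by rewrite /cmod RRe_real// ger0_real. Qed.

Lemma cmodE z : cmod z = Num.sqrt (complex.Re z ^+ 2 + complex.Im z ^+ 2).
Proof. by rewrite /cmod normc_def. Qed.

Lemma cmod_ge0 z : 0 <= cmod z.
Proof. by rewrite cmodE sqrtr_ge0. Qed.

Lemma cmod_sqr z : cmod z ^+ 2 = complex.Re z ^+ 2 + complex.Im z ^+ 2.
Proof. by rewrite cmodE sqr_sqrtr// addr_ge0 ?sqr_ge0. Qed.

Lemma cmodM z w : cmod (z * w) = cmod z * cmod w.
Proof. by apply: complexI; rewrite rmorphM/= -!norm_cmod normrM. Qed.

Lemma cmodX z n : cmod (z ^+ n) = cmod z ^+ n.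
Proof. by apply: complexI; rewrite rmorphXn/= -!norm_cmod normrX. Qed.

Lemma cmodD z w : cmod (z + w) <= cmod z + cmod w.
Proof. by rewrite -lecR rmorphD/= -!norm_cmod ler_normD. Qed.

Lemma cmod_le_ReIm z : cmod z <= `|complex.Re z| + `|complex.Im z|.
Proof.
rewrite -ler_sqr ?nnegrE ?cmod_ge0 ?addr_ge0// cmod_sqr sqrrD !real_normK ?num_real//.
by rewrite -addrA lerD2l lerDr mulrn_wge0// mulr_ge0.
Qed.

Lemma cmodN z : cmod (- z) = cmod z.
Proof. by rewrite /cmod normrN. Qed.

Lemma cmod1 : cmod (1 : R[i]) = 1.
Proof. by rewrite /cmod normr1. Qed.

Lemma cmod_conj z : cmod (Num.conj z) = cmod z.
Proof. by rewrite /cmod norm_conjC. Qed.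

Lemma cmod_real (a : R) : 0 <= a -> cmod a%:C%C = a.
Proof. by move=> a0; rewrite /cmod ger0_norm// lecR. Qed.

Lemma Re_le_cmod z : complex.Re z <= cmod z.
Proof.
rewrite cmodE; apply: le_trans (ler_norm _) _.
by rewrite -sqrtr_sqr ler_wsqrtr// lerDl sqr_ge0.
Qed.

Lemma ReD z w : complex.Re (z + w) = complex.Re z + complex.Re w.
Proof. by case: z; case: w. Qed.
Lemma ReN z : complex.Re (- z) = - complex.Re z.
Proof. by case: z. Qed.
Lemma Re_conjE z : complex.Re (Num.conj z) = complex.Re z.
Proof. by case: z. Qed.
Lemma Re_realM (a : R) z : complex.Re (a%:C%C * z) = a * complex.Re z.
Proof. by case: z => x y /=; ring. Qed.
End ComplexModulus.

Section InnerProduct.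
Context {R : realType} {H : completeNormedModType R[i]}.
Implicit Types x y u v : H.

Lemma norm_hnorm x : `|x| = (hnorm x)%:C%C.
Proof. by rewrite /hnorm RRe_real// ger0_real. Qed.

Lemma hnorm_ge0 x : 0 <= hnorm x.
Proof. by have := normr_ge0 x; rewrite norm_hnorm lecR. Qed.

Lemma hnorm_triangle x y : hnorm (x + y) <= hnorm x + hnorm y.
Proof. by rewrite -lecR rmorphD/= -!norm_hnorm ler_normD. Qed.

Lemma hnorm_scale a x : hnorm (a *: x) = cmod a * hnorm x.
Proof. by apply: complexI; rewrite rmorphM/= -norm_cmod -!norm_hnorm normrZ. Qed.

Lemma hnorm_opp x : hnorm (- x) = hnorm x.
Proof. by rewrite /hnorm normrN. Qed.

Lemma hnorm_distC x y : hnorm (x - y) = hnorm (y - x).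
Proof. by rewrite /hnorm distrC. Qed.

Lemma hnorm0 : hnorm (0 : H) = 0.
Proof. by rewrite /hnorm normr0. Qed.

Lemma hnorm_le0_eq0 x : hnorm x <= 0 -> x = 0.
Proof.
by rewrite -lecR -norm_hnorm normr_le0 => /eqP.
Qed.

Context (dot : {dot H for Num.conj}).
Context (dot_norm : forall x : H, dot x x = `|x| ^+ 2).

Definition rdot x y : R := complex.Re (dot x y).

Lemma hnorm_sqr x : hnorm x ^+ 2 = rdot x x.
Proof. by rewrite /rdot dot_norm norm_hnorm -rmorphXn. Qed.

Lemma dot_conj x y : dot x y = Num.conj (dot y x).
Proof. by rewrite hermC expr0 mul1r. Qed.

Lemma rdotC x y : rdot x y = rdot y x.
Proof. by rewrite /rdot dot_conj Re_conjE. Qed.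

Lemma rdotDl x y v : rdot (x + y) v = rdot x v + rdot y v.
Proof. by rewrite /rdot linearDl ReD. Qed.

Lemma rdotNl x v : rdot (- x) v = - rdot x v.
Proof. by rewrite /rdot linearNl ReN. Qed.

Lemma rdotDr x y v : rdot v (x + y) = rdot v x + rdot v y.
Proof. by rewrite rdotC rdotDl !(rdotC v). Qed.

Lemma rdotNr x v : rdot v (- x) = - rdot v x.
Proof. by rewrite rdotC rdotNl rdotC. Qed.

Lemma rdot_scalel a x y : rdot (a *: x) y = rdot x (Num.conj a *: y).
Proof. by rewrite /rdot linearZl_LR linearZr_LR /= conjCK. Qed.

Lemma rdot_realZl (a : R) x y : rdot (a%:C%C *: x) y = a * rdot x y.
Proof. by rewrite /rdot linearZl_LR /= Re_realM. Qed.

Lemma hnormD_sqr x y :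
  hnorm (x + y) ^+ 2 = hnorm x ^+ 2 + hnorm y ^+ 2 + 2 * rdot x y.
Proof.
rewrite !hnorm_sqr !(rdotDl, rdotDr) (rdotC y x); ring.
Qed.

Lemma hnormB_sqr x y :
  hnorm (x - y) ^+ 2 = hnorm x ^+ 2 + hnorm y ^+ 2 - 2 * rdot x y.
Proof. by rewrite hnormD_sqr hnorm_opp rdotNr; ring. Qed.

Lemma hnorm_realZ (a : R) x : hnorm (a%:C%C *: x) ^+ 2 = a ^+ 2 * hnorm x ^+ 2.
Proof. by rewrite !hnorm_sqr rdot_realZl rdotC rdot_realZl; ring. Qed.

Lemma rdot_le x y : rdot x y <= hnorm x * hnorm y.
Proof.
have [x0|x0] := eqVneq (hnorm x) 0.
  have -> : x = 0 by apply: hnorm_le0_eq0; rewrite x0.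
  by rewrite /rdot linear0l hnorm0 mul0r.
have xp : 0 < hnorm x by rewrite lt_def x0 hnorm_ge0.
have := sqr_ge0 (hnorm ((hnorm y)%:C%C *: x - (hnorm x)%:C%C *: y)).
rewrite hnormB_sqr !hnorm_realZ rdot_realZl (rdotC x) rdot_realZl (rdotC y x).
have := hnorm_ge0 y; rewrite le_eqVlt => /orP[/eqP y0|yp] h.
  have -> : y = 0 by apply: hnorm_le0_eq0; rewrite -y0.
  by rewrite /rdot linear0r hnorm0 mulr0.
have pp : 0 < 2 * (hnorm y * hnorm x) by rewrite mulr_gt0// mulr_gt0.
by rewrite -subr_ge0 -(pmulr_rge0 _ pp); lra.
Qed.

Lemma rdot_ge x y : - (hnorm x * hnorm y) <= rdot x y.
Proof. by have := rdot_le x (- y); rewrite rdotNr hnorm_opp; lra. Qed.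

(** Multiplying the first argument by 1 and by the imaginary unit recovers a
    complex inner product from its real part. *)
Lemma rdot_scale_eq_dot u v u' v' :
  (forall a, rdot (a *: u) v = rdot (a *: u') v') -> dot u v = dot u' v'.
Proof.
move=> h; have := h 1; have := h 'i%C.
rewrite /rdot !linearZl_LR /=; case: (dot u v) => a b; case: (dot u' v') => c d.
by move=> /= h1 h2; congr Complex; lra.
Qed.
End InnerProduct.

(** * Completeness and fixed points *)
Lemma le0_small {R : realType} (x K : R) :
  (forall e, 0 < e -> x <= e * K) -> x <= 0.
Proof.
move=> xK; apply/ler_addgt0Pr => e e0; rewrite add0r.
have K1 : 0 < `|K| + 1 by rewrite ltr_wpDl.
apply: le_trans (xK _ (divr_gt0 e0 K1)) _.
rewrite mulrAC ler_pdivrMr// ler_pM2l//.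
by apply: le_trans (ler_norm _) _; rewrite lerDl.
Qed.

Lemma geometric_small {R : realType} (q c : R) : 0 <= q -> q < 1 -> 0 <= c ->
  forall e, 0 < e -> exists n, c * q ^+ n < e.
Proof.
move=> q0 q1 c0 e e0.
have qlim : (fun n => q ^+ n) @ \oo --> (0 : R) by apply: cvg_expr; rewrite ger0_norm.
have c1 : 0 < c + 1 by rewrite ltr_wpDl.
have /cvgrPdist_lt/(_ _ (divr_gt0 e0 c1))[n _ /(_ n (leqnn n)) /=] := qlim.
rewrite sub0r normrN ger0_norm ?exprn_ge0// ltr_pdivlMr// => qn.
by exists n; apply: le_lt_trans qn; rewrite mulrC ler_wpM2l ?exprn_ge0// lerDl.
Qed.

Section Completeness.
Context {R : realType} {H : completeNormedModType R[i]}.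
Implicit Types (x y l : H) (u w : nat -> H).

Lemma hnorm_cvgP u l : u @ \oo --> l <->
  forall e : R, 0 < e -> \forall n \near \oo, hnorm (u n - l) < e.
Proof.
split.
- move=> /cvgrPdist_lt ul e e0.
  have ec : 0 < e%:C%C :> R[i] by rewrite ltcR.
  have := ul _ ec; apply: filterS => n.
  by rewrite norm_hnorm ltcR hnorm_distC.
- move=> ul; apply/cvgrPdist_lt => e e0.
  have eE : e = (complex.Re e)%:C%C by rewrite RRe_real// gtr0_real.
  have e0' : 0 < complex.Re e by rewrite -ltcR -eE.
  have := ul _ e0'; apply: filterS => n.
  by rewrite eE norm_hnorm ltcR hnorm_distC.
Qed.

Lemma hnorm_cauchy_cvg u (d : nat -> R) :
  (forall e : R, 0 < e -> exists N, d N < e) ->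
  (forall N m n, (N <= m)%N -> (N <= n)%N -> hnorm (u m - u n) <= d N) ->
  exists l, u @ \oo --> l.
Proof.
move=> d0 ud.
have : cvg (u @ \oo).
  apply/cauchy_cvgP/cauchy_ballP => e e0.
  have eE : e = (complex.Re e)%:C%C by rewrite RRe_real// gtr0_real.
  have e0' : 0 < complex.Re e by rewrite -ltcR -eE.
  have [N dN] := d0 _ e0'.
  pose tail := [set u n | n in [set n | (N <= n)%N]].
  exists (tail, tail); first by split; exists N => // n Nn; exists n.
  move=> [_ _] [/= [m Nm <-] [n Nn <-]].
  rewrite -ball_normE /= eE norm_hnorm ltcR.
  exact: le_lt_trans (ud _ _ _ Nm Nn) dN.
by move=> ul; exists (lim (u @ \oo)).
Qed.

(** The iterates of 0 move by at most q^n times the first step, hence are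
    Cauchy; their limit is fixed because phi is Lipschitz. *)
Lemma hnorm_fixed_point (phi : H -> H) (q : R) : 0 <= q -> q < 1 ->
  (forall x y, hnorm (phi x - phi y) <= q * hnorm (x - y)) ->
  exists x, phi x = x.
Proof.
move=> q0 q1 phi_lip.
pose u n := iter n phi 0; pose D := hnorm (u 1%N - u 0%N).
have D0 : 0 <= D := hnorm_ge0 _.
have q1' : 0 < 1 - q by rewrite subr_gt0.
have step n : hnorm (u n.+1 - u n) <= q ^+ n * D.
  elim: n => [|n IHn]; first by rewrite expr0 mul1r.
  apply: le_trans (phi_lip _ _) _; rewrite exprS -mulrA; exact: ler_wpM2l.
(* Multiplying by 1 - q turns the geometric sum into a telescoping one. *)
have tail n k : (1 - q) * hnorm (u (n + k)%N - u n) <= q ^+ n * D * (1 - q ^+ k).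
  elim: k => [|k IHk]; first by rewrite addn0 subrr hnorm0 expr0 subrr !mulr0.
  have := hnorm_triangle (u (n + k.+1)%N - u (n + k)%N) (u (n + k)%N - u n).
  rewrite addrA subrK addnS => /(ler_wpM2l (ltW q1')) tri.
  have := ler_wpM2l (ltW q1') (step (n + k)%N).
  by move: IHk tri; rewrite exprD exprS; lra.
have dist n N : (N <= n)%N -> hnorm (u n - u N) <= D / (1 - q) * q ^+ N.
  move=> Nn; rewrite mulrAC ler_pdivlMr// mulrC -(subnKC Nn).
  apply: le_trans (tail _ _) _; rewrite (mulrC D) ler_piMr ?mulr_ge0 ?exprn_ge0//.
  by rewrite gerBl exprn_ge0.
have c0 : 0 <= D / (1 - q) + D / (1 - q) by rewrite addr_ge0 ?divr_ge0 ?(ltW q1').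
have [l ul] : exists l : H, u @ \oo --> l.
  apply: (@hnorm_cauchy_cvg u (fun N => (D / (1 - q) + D / (1 - q)) * q ^+ N)).
    exact: geometric_small.
  move=> N m n Nm Nn; rewrite mulrDl.
  apply: le_trans (lerD (dist _ _ Nm) (dist _ _ Nn)).
  have := hnorm_triangle (u m - u N) (u N - u n).
  by rewrite addrA subrK (hnorm_distC (u N)).
exists l; apply/eqP; rewrite -subr_eq0; apply/eqP/hnorm_le0_eq0.
apply: (@le0_small _ _ (q + 1)) => e e0.
have /hnorm_cvgP/(_ _ e0)[n _ un] := ul.
have h1 := un n (leqnn n); have h2 := un n.+1 (leqnSn n).
have h3 := phi_lip l (u n); rewrite (hnorm_distC l) in h3.
have h4 : q * hnorm (u n - l) <= q * e := ler_wpM2l q0 (ltW h1).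
have := hnorm_triangle (phi l - u n.+1) (u n.+1 - l); rewrite addrA subrK.
by move: h2 h3 h4; rewrite /= -/(u n) -[phi (u n)]/(u n.+1); lra.
Qed.

Lemma closed_operator_seq (T : operator H) u x y :
  closed_operator T -> (forall n, op_dom T (u n)) ->
  u @ \oo --> x -> (T \o u) @ \oo --> y -> op_dom T x /\ T x = y.
Proof.
move=> clT uD ux Tuy.
pose G := [set xy : H * H | op_dom T xy.1 /\ xy.2 = T xy.1].
have uG : \forall n \near \oo, G (u n, T (u n)).
  by apply: nearW => n; split => //=; exact: uD.
have uTu : (fun n => (u n, T (u n))) @ \oo --> (x, y) by exact: cvg_pair.
by have [/= Dx ->] := closed_cvg G clT uG _ uTu.
Qed.

End Completeness.

(** * Unbounded linear operators *)
Section LinearOperators.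
Context {R : realType} {H : completeNormedModType R[i]}.
Context (T : operator H).
Context (T_lin : linear_operator T).
Implicit Types (x y u v : H) (a z : R[i]).

Lemma op_dom0 : op_dom T 0. Proof. by case: T_lin. Qed.

Lemma op_domZ a x : op_dom T x -> op_dom T (a *: x).
Proof. by case: T_lin => D0 DD _ Dx; rewrite -[_ *: _]addr0; exact: DD. Qed.

Lemma op_domD x y : op_dom T x -> op_dom T y -> op_dom T (x + y).
Proof. by case: T_lin => _ DD _ Dx Dy; rewrite -[x]scale1r; exact: DD. Qed.

Lemma op_domB x y : op_dom T x -> op_dom T y -> op_dom T (x - y).
Proof. by move=> Dx Dy; rewrite -scaleN1r; exact/op_domD/op_domZ. Qed.

Lemma opD x y : op_dom T x -> op_dom T y -> T (x + y) = T x + T y.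
Proof.
by case: T_lin => _ _ TD Dx Dy; have := TD 1 _ _ Dx Dy; rewrite !scale1r.
Qed.

Lemma op0 : T 0 = 0.
Proof. by apply: (addIr (T 0)); rewrite -(opD op_dom0 op_dom0) !add0r. Qed.

Lemma opZ a x : op_dom T x -> T (a *: x) = a *: T x.
Proof.
case: T_lin => D0 _ TD Dx; have := TD a _ _ Dx D0.
by rewrite op0 !addr0.
Qed.

Lemma opB x y : op_dom T x -> op_dom T y -> T (x - y) = T x - T y.
Proof.
by move=> Dx Dy; rewrite -scaleN1r (opD Dx (op_domZ _ Dy)) opZ// !scaleN1r.
Qed.

Lemma linear_operator_shift z : linear_operator (op_shift T z).
Proof.
split=> [|a x y Dx Dy|a x y Dx Dy] /=; first exact: op_dom0.
  exact: (op_domD (op_domZ a Dx) Dy).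
rewrite (opD (op_domZ a Dx) Dy) (opZ a Dx).
by rewrite scalerBr (scalerDr z) opprD !scalerA (mulrC z) addrACA.
Qed.

Context (dot : {dot H for Num.conj}).
Context (dot_norm : forall x : H, dot x x = `|x| ^+ 2).
Local Notation redot := (rdot dot).
Context (T_closed : closed_operator T).

(** The weak Euler equation of the functional J u = |x - u|^2 + e^2 |T u|^2 on
    the domain of T; equivalently, (u, T u) is the orthogonal projection of
    (x, 0) on the graph of T for the norm weighted by e.  The minimiser exists
    since the graph is closed: by the parallelogram identity a minimising
    sequence is Cauchy together with its image by T. *)
Lemma graph_projection x (e : R) : op_dom T x -> 0 < e ->
  exists u, op_dom T u /\
    forall v, op_dom T v -> redot (x - u) v = e ^+ 2 * redot (T u) (T v).
Proof.
move=> Dx e0.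
pose J u := hnorm (x - u) ^+ 2 + e ^+ 2 * hnorm (T u) ^+ 2.
pose B u v := e ^+ 2 * redot (T u) (T v) - redot (x - u) v.
pose Q v := hnorm v ^+ 2 + e ^+ 2 * hnorm (T v) ^+ 2.
have JE u v (t : R) : op_dom T u -> op_dom T v ->
    J (u + t%:C%C *: v) = J u + 2 * t * B u v + t ^+ 2 * Q v.
  move=> Du Dv; rewrite /J /B /Q opD ?opZ//; last exact: op_domZ.
  rewrite opprD addrA (hnormB_sqr dot_norm (x - u)) (hnormD_sqr dot_norm (T u)).
  rewrite !(hnorm_realZ dot_norm).
  rewrite [redot (x - u) (t%:C%C *: v)]rdotC [redot (T u) (t%:C%C *: _)]rdotC.
  rewrite !rdot_realZl (rdotC _ v) (rdotC _ (T v)); ring.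
pose E := [set J u | u in op_dom T].
have J_ge0 u : 0 <= J u.
  exact: addr_ge0 (sqr_ge0 _) (mulr_ge0 (sqr_ge0 _) (sqr_ge0 _)).
have E_lb : has_lbound E by exists 0 => _ [u _ <-].
have E_inf : has_inf E by split => //; exists (J x); exists x.
pose m := inf E.
have mJ u : op_dom T u -> m <= J u by move=> Du; apply: ge_inf => //; exists u.
(* J (u n) exceeds the infimum m by less than d n squared: the square makes the
   distances between minimising points linear in d. *)
pose d n : R := n.+1%:R^-1.
have d_gt0 n : 0 < d n by rewrite invr_gt0 ltr0n.
have d_le N n : (N <= n)%N -> d n <= d N.
  by move=> Nn; rewrite lef_pV2 ?posrE ?ltr0n// ler_nat ltnS.
have /choice[u uP] : forall n, exists u, op_dom T u /\ J u < m + d n ^+ 2.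
  move=> n; have [_ [u Du <-] Ju] := inf_adherent (exprn_gt0 2 (d_gt0 n)) E_inf.
  by exists u.
have uD n := (uP n).1.
(* The derivative B is almost zero at u n: compare J (u n) with its values at
   u n + d n v and at u n - d n v, which are at least m. *)
have Bu n v : op_dom T v -> `|B (u n) v| <= d n * (1 + Q v).
  move=> Dv.
  have hp := mJ _ (op_domD (uD n) (op_domZ (d n)%:C%C Dv)).
  have hm := mJ _ (op_domD (uD n) (op_domZ (- d n)%:C%C Dv)).
  have := (uP n).2; move: hp hm; rewrite !JE//.
  set b := B _ _; set q := Q v; set j := J _; set dn := d n => hp hm hj.
  have dn0 : 0 < dn by exact: d_gt0.
  rewrite ler_norml; apply/andP; split; rewrite -(ler_pM2l dn0); nra.
(* Parallelogram identity, from the value of J at the midpoint. *)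
have Qu N i j : (N <= i)%N -> (N <= j)%N -> Q (u i - u j) <= (2 * d N) ^+ 2.
  move=> Ni Nj; have Duv := op_domB (uD i) (uD j).
  have h1 := mJ _ (op_domD (uD j) (op_domZ (2^-1)%:C%C Duv)).
  have := JE (u j) (u i - u j) 1 (uD j) Duv.
  rewrite scale1r addrC subrK => h2.
  move: h1; rewrite JE// => h1.
  have := (uP i).2; have := (uP j).2.
  have d_sqr n : (N <= n)%N -> d n ^+ 2 <= d N ^+ 2.
    by move=> Nn; rewrite ler_sqr ?nnegrE ?(ltW (d_gt0 _))// d_le.
  have := d_sqr _ Ni; have := d_sqr _ Nj.
  move: h1 h2; set q := Q _; set b := B _ _; set ji := J _; set jj := J _.
  set di := d i ^+ 2; set dj := d j ^+ 2; set dN := d N ^+ 2.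
  rewrite exprMn -/dN => h1 h2 hj hi hJi hJj; lra.
have d_small (c : R) : 0 < c -> forall eta : R, 0 < eta -> exists N, c * d N < eta.
  move=> c0 eta eta0.
  have [N _ /(_ N (leqnn _)) dN] := near_infty_natSinv_lt (PosNum (divr_gt0 eta0 c0)).
  by exists N; rewrite mulrC -ltr_pdivlMr.
have [l ul] : exists l : H, u @ \oo --> l.
  have two0 : 0 < 2 :> R by [].
  apply: (@hnorm_cauchy_cvg _ _ u (fun N => 2 * d N) (d_small _ two0)).
  move=> N i j Ni Nj.
  rewrite -ler_sqr ?nnegrE ?hnorm_ge0 ?mulr_ge0 ?(ltW (d_gt0 N))//.
  apply: le_trans (Qu N i j Ni Nj).
  by rewrite /Q lerDl; exact: mulr_ge0 (sqr_ge0 _) (sqr_ge0 _).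
have [w uw] : exists w : H, (T \o u) @ \oo --> w.
  have e20 : 0 < 2 / e by rewrite divr_gt0.
  apply: (@hnorm_cauchy_cvg _ _ (T \o u) (fun N => 2 / e * d N) (d_small _ e20)).
  move=> N i j Ni Nj /=.
  rewrite mulrAC ler_pdivlMr// -ler_sqr ?nnegrE ?mulr_ge0 ?hnorm_ge0 ?(ltW e0)
    ?(ltW (d_gt0 N))//.
  apply: le_trans (Qu N i j Ni Nj).
  by rewrite /Q opB// exprMn [X in X <= _]mulrC lerDr sqr_ge0.
have [Dl Tl] := closed_operator_seq T_closed uD ul uw.
exists l; split=> // v Dv.
suff : `|B l v| <= 0 by rewrite normr_le0 subr_eq0 => /eqP ->.
apply: (@le0_small _ _ (1 + Q v + hnorm v + e ^+ 2 * hnorm (T v))) => eta eta0.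
have [N dN] := d_small 1 ltr01 eta eta0.
have [N1 _ hN1] := (hnorm_cvgP u l).1 ul _ eta0.
have [N2 _ hN2] := (hnorm_cvgP (T \o u) w).1 uw _ eta0.
pose n := maxn N (maxn N1 N2).
have {hN1}h1 : hnorm (u n - l) < eta.
  by apply: hN1; rewrite /= /n !leq_max leqnn orbT.
have {hN2}h2 : hnorm (T (u n) - w) < eta.
  by apply: hN2; rewrite /= /n !leq_max leqnn !orbT.
have {dN}h3 : d n <= eta.
  by apply: le_trans (d_le N n (leq_maxl _ _)) _; rewrite -[d N]mul1r ltW.
have BE : B l v = B (u n) v - e ^+ 2 * redot (T (u n) - w) (T v) - redot (u n - l) v.
  by rewrite /B Tl !(rdotDl, rdotNl); ring.
have a1 := rdot_le dot_norm (T (u n) - w) (T v).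
have a2 := rdot_ge dot_norm (T (u n) - w) (T v).
have b1 := rdot_le dot_norm (u n - l) v.
have b2 := rdot_ge dot_norm (u n - l) v.
have := Bu n v Dv; rewrite ler_norml => /andP[c1 c2].
have Q0 : 0 <= 1 + Q v.
  apply: addr_ge0 ler01 (addr_ge0 (sqr_ge0 _) _).
  exact: mulr_ge0 (sqr_ge0 _) (sqr_ge0 _).
have d1 := ler_wpM2r Q0 h3.
have d2 := ler_wpM2r (hnorm_ge0 v) (ltW h1).
have d3 := ler_wpM2l (sqr_ge0 e) (ler_wpM2r (hnorm_ge0 (T v)) (ltW h2)).
have a3 := ler_wpM2l (sqr_ge0 e) a1.
have a4 := ler_wpM2l (sqr_ge0 e) a2.
rewrite BE ler_norml; apply/andP; split; lra.
Qed.

End LinearOperators.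

(** * The key inequality for normal operators *)
Section NormalOperators.
Context {R : realType} {H : completeNormedModType R[i]}.
Context (dot : {dot H for Num.conj}).
Context (dot_norm : forall x : H, dot x x = `|x| ^+ 2).
Local Notation redot := (rdot dot).
Implicit Types (x y u v : H) (a z : R[i]) (T S : operator H).

Lemma adjointP T x y : op_dom T x -> op_dom (adjoint dot T) y ->
  dot (T x) y = dot x (adjoint dot T y).
Proof.
move=> Dx [w wP].
pose image_of_y := [set w | forall x, op_dom T x -> dot (T x) y = dot x w].
exact: (@getPex _ image_of_y (ex_intro _ w wP)).
Qed.

(** The Euler equation at the minimiser u says that T u lies in the domain of
    the adjoint, with image (x - u)/e^2.  Testing it on x - u itself gives
    |x - u|^2 = e^2 (Re <T u, T x> - |T u|^2), from which the three estimates
    follow.  The last one says that T u and T (u - x) form an obtuse angle. *)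
Lemma approx_by_dom_adjoint_comp T x (e : R) : linear_operator T -> closed_operator T ->
  op_dom T x -> 0 < e ->
  exists u, [/\ op_dom (op_comp (adjoint dot T) T) u,
    hnorm (x - u) <= e * hnorm (T x), hnorm (T u) <= hnorm (T x)
    & hnorm (T u) ^+ 2 <= redot (T u) (T x)].
Proof.
move=> T_lin T_closed Dx e0.
have [u [Du uP]] := graph_projection T_lin dot_norm T_closed Dx e0.
have e20 : 0 < e ^+ 2 by exact: exprn_gt0.
have := uP _ (op_domB T_lin Dx Du).
rewrite opB// [redot (T u) _]rdotDr rdotNr -!(hnorm_sqr dot_norm) => xu.
have TuTx : hnorm (T u) ^+ 2 <= redot (T u) (T x).
  by rewrite -subr_ge0 -(pmulr_rge0 _ e20) -xu sqr_ge0.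
have Tule : hnorm (T u) <= hnorm (T x).
  have := rdot_le dot_norm (T u) (T x); have := hnorm_ge0 (T u).
  rewrite le_eqVlt => /orP[/eqP <-|Tu0 h]; first by rewrite hnorm_ge0.
  by rewrite -(ler_pM2l Tu0); apply: le_trans h; rewrite -expr2.
exists u; split=> //=.
  split=> //; exists ((e ^- 2)%:C%C *: (x - u)) => v Dv.
  apply: rdot_scale_eq_dot => a.
  have Dav := op_domZ T_lin a Dv.
  rewrite -opZ// (rdotC _ (a *: v)) rdot_realZl uP// mulrA mulVf ?gt_eqF// mul1r.
  exact: rdotC.
rewrite -ler_sqr ?nnegrE ?mulr_ge0 ?hnorm_ge0 ?(ltW e0)//.
rewrite xu exprMn ler_pM2l//.
apply: (@le_trans _ _ (redot (T u) (T x))); first by rewrite gerBl sqr_ge0.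
apply: le_trans (rdot_le dot_norm _ _) _.
by rewrite expr2 ler_wpM2r// hnorm_ge0.
Qed.

(** Let T' be the adjoint.  On the common domain of T T' and T' T one has
    |T' u|^2 = <T T' u, u> = <T' T u, u> = |T u|^2, and the shift by z adds to
    both squares the same cross term, up to conjugation. *)
Lemma adjoint_shift_norm T z u : normal_operator dot T ->
  op_dom (op_comp (adjoint dot T) T) u ->
  op_dom (adjoint dot T) u /\
  hnorm (adjoint dot T u) = hnorm (T u) /\
  hnorm (adjoint dot T u - Num.conj z *: u) = hnorm (T u - z *: u).
Proof.
move=> [T_lin _ _ [dom_eq fun_eq]] Du.
have [Du0 DTu] := Du.
have [Dsu DTsu] : op_dom (op_comp T (adjoint dot T)) u by rewrite dom_eq.
have TTE := fun_eq u (conj Dsu DTsu).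
have sqE : hnorm (adjoint dot T u) ^+ 2 = hnorm (T u) ^+ 2.
  rewrite !(hnorm_sqr dot_norm) /rdot.
  rewrite -(adjointP DTsu Dsu) (adjointP Du0 DTu) dot_conj Re_conjE.
  by rewrite /= in TTE; rewrite TTE.
split=> //; split.
  by apply/eqP; rewrite -(eqrXn2 (n := 2)) ?hnorm_ge0 ?sqE.
apply/eqP; rewrite -(eqrXn2 (n := 2)) ?hnorm_ge0//; apply/eqP.
rewrite !(hnormB_sqr dot_norm) sqE !hnorm_scale cmod_conj; congr (_ - 2 * _).
rewrite /rdot !linearZr_LR /= conjCK.
rewrite (dot_conj dot (adjoint dot T u)) -(adjointP Du0 Dsu).
by rewrite -[z in LHS]conjCK -rmorphM Re_conjE.
Qed.

(** With S = T - z, this is the Cauchy-Schwarz inequality for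
    <S v, x> = <v, S' x> combined with |S' x| = |S x|, but stated without S', so
    that x need not be known to lie in the domain of the adjoint.  The inequality
    is exact at the approximations u of x, and |S u| exceeds |S x| by a quantity
    that vanishes with e. *)
Lemma normal_rdot_shift_le T z v x : normal_operator dot T ->
  op_dom T v -> op_dom T x ->
  redot (op_shift T z v) x <= hnorm v * hnorm (op_shift T z x).
Proof.
move=> T_normal Dv Dx; have [T_lin _ T_closed _] := T_normal.
pose S := op_shift T z.
have S_lin : linear_operator S := linear_operator_shift T_lin z.
rewrite -/S; pose tau := hnorm (T x).
have tau0 : 0 <= tau := hnorm_ge0 _.
pose K := 2 * cmod z * tau * (tau + (tau + cmod z * (hnorm x + tau))).
have z0 := cmod_ge0 z; have x0 := hnorm_ge0 x.
have K0 : 0 <= K by rewrite /K !(mulr_ge0, addr_ge0).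
(* |S x|^2 = |S u|^2 - 2 Re <S u, S (u - x)> + |S (u - x)|^2, and the cross term
   splits into a nonpositive part and two parts controlled by |u - x|, one of
   them after moving T to the other side through the adjoint at u. *)
have bound (e : R) : 0 < e -> e <= 1 ->
    exists u, [/\ hnorm (x - u) <= e * tau, redot (S v) u <= hnorm v * hnorm (S u)
      & hnorm (S u) ^+ 2 <= hnorm (S x) ^+ 2 + e * K].
  move=> e0 e1; have [u [Duu xu Tu_le Tu]] := approx_by_dom_adjoint_comp T_lin T_closed Dx e0.
  have [Dsu [nsu nsu_shift]] := adjoint_shift_norm z T_normal Duu.
  have Du : op_dom T u := Duu.1.
  exists u; split=> //.
    rewrite /S /= rdotDl rdotNl rdot_scalel {1}/rdot (adjointP Dv Dsu).
    rewrite -rdotNr -rdotDr -nsu_shift; exact: rdot_le dot_norm _ _.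
  have De : op_dom T (u - x) := op_domB T_lin Du Dx.
  have xE : S x = S u - S (u - x) by rewrite (opB S_lin)// subKr.
  have e_le : hnorm (u - x) <= e * tau by rewrite hnorm_distC.
  have u_le : hnorm u <= hnorm x + tau.
    rewrite -[u](subrK x) addrC; apply: le_trans (hnorm_triangle _ _) _.
    by rewrite lerD2l; apply: le_trans e_le _; rewrite ler_piMl.
  have Su_le : hnorm (S u) <= tau + cmod z * (hnorm x + tau).
    apply: le_trans (hnorm_triangle _ _) _; rewrite hnorm_opp hnorm_scale.
    by rewrite lerD// ler_wpM2l.
  have TuTe : redot (T u) (T (u - x)) <= 0.
    by rewrite opB// rdotDr rdotNr -(hnorm_sqr dot_norm) subr_le0.
  have zuTe : - (cmod z * (e * tau) * tau) <= redot (z *: u) (T (u - x)).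
    rewrite rdot_scalel -opZ// rdotC.
    have Dze := op_domZ T_lin (Num.conj z) De.
    rewrite {1}/rdot (adjointP Dze Dsu).
    apply: le_trans (rdot_ge dot_norm _ _).
    rewrite lerN2 hnorm_scale cmod_conj nsu.
    by rewrite ler_pM ?mulr_ge0 ?hnorm_ge0// ler_wpM2l.
  have Suze : - ((tau + cmod z * (hnorm x + tau)) * (cmod z * (e * tau)))
      <= redot (S u) (z *: (u - x)).
    apply: le_trans (rdot_ge dot_norm _ _).
    rewrite lerN2 hnorm_scale.
    by rewrite ler_pM ?mulr_ge0 ?hnorm_ge0// ler_wpM2l.
  have SuSe : 2 * redot (S u) (S (u - x)) <= e * K.
    have -> : redot (S u) (S (u - x)) =
        redot (T u) (T (u - x)) - redot (z *: u) (T (u - x))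
          - redot (S u) (z *: (u - x)).
      rewrite /S /= rdotDr rdotNr; congr (_ - _).
      by rewrite rdotDl rdotNl.
    by rewrite /K; lra.
  rewrite xE (hnormB_sqr dot_norm (S u) (S (u - x))).
  by have := sqr_ge0 (hnorm (S (u - x))); lra.
rewrite -subr_le0; apply: (@le0_small _ _ (hnorm v + 1)) => eta eta0.
have Sv0 := hnorm_ge0 (S v).
pose e := Num.min 1 (Num.min (eta ^+ 2 / (K + 1)) (eta / (hnorm (S v) * tau + 1))).
have K1 : 0 < K + 1 by rewrite ltr_wpDl.
have L1 : 0 < hnorm (S v) * tau + 1 by rewrite ltr_wpDl// mulr_ge0.
have e0 : 0 < e by rewrite /e !lt_min ltr01 !divr_gt0// exprn_gt0.
have e1 : e <= 1 by rewrite /e ge_min lexx.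
have eK : e * K <= eta ^+ 2.
  apply: (@le_trans _ _ (e * (K + 1))); first by rewrite ler_pM2l// lerDl.
  by rewrite -ler_pdivlMr// /e !ge_min lexx orbT.
have eL : e * (hnorm (S v) * tau) <= eta.
  apply: (@le_trans _ _ (e * (hnorm (S v) * tau + 1))).
    by rewrite ler_pM2l// lerDl.
  by rewrite -ler_pdivlMr// /e !ge_min lexx !orbT.
have [u [xu Svu Su]] := bound e e0 e1.
have Sx0 := hnorm_ge0 (S x).
have Su_le : hnorm (S u) <= hnorm (S x) + eta.
  rewrite -ler_sqr ?nnegrE ?hnorm_ge0 ?addr_ge0 ?(ltW eta0)//.
  apply: le_trans Su _; have := mulr_ge0 Sx0 (ltW eta0); nra.
have Svxu : redot (S v) (x - u) <= eta.
  apply: le_trans (rdot_le dot_norm _ _) _; apply: le_trans eL.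
  by rewrite mulrCA ler_wpM2l.
have -> : redot (S v) x = redot (S v) u + redot (S v) (x - u).
  by rewrite -rdotDr addrC subrK.
have := ler_wpM2l (hnorm_ge0 v) Su_le; lra.
Qed.

End NormalOperators.

(** * Spectral radius by averaging over roots of unity *)
Section SpectralRadius.
Context {R : realType} {H : completeNormedModType R[i]}.
Context (N : H -> H).
Context (N_lin : forall (a : R[i]) x y, N (a *: x + y) = a *: N x + N y).
Implicit Types (x y : H) (w : R[i]) (F : R[i] -> H -> H).

Lemma iter_linear n (a : R[i]) x y :
  iter n N (a *: x + y) = a *: iter n N x + iter n N y.
Proof. by elim: n => //= n ->. Qed.

Lemma iter_bound n (t : R) x : 0 <= t ->
  (forall y, t * hnorm (N y) <= hnorm y) -> t ^+ n * hnorm (iter n N x) <= hnorm x.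
Proof.
move=> t0 tN; elim: n => [|n IHn]; first by rewrite expr0 mul1r.
apply: le_trans IHn; rewrite exprSr -mulrA ler_wpM2l ?exprn_ge0//; exact: tN.
Qed.

(** The sequence |N^k x| is logarithmically convex, so its successive ratios
    increase and each is at least the first one, |N x| / |x|. *)
Lemma log_convex_iter :
  (forall x, hnorm (N x) ^+ 2 <= hnorm x * hnorm (N (N x))) ->
  forall n x, hnorm (N x) ^+ n.+1 <= hnorm x ^+ n * hnorm (iter n.+1 N x).
Proof.
move=> N_para n x.
have step k : hnorm (N x) * hnorm (iter k N x) <= hnorm x * hnorm (iter k.+1 N x).
  elim: k => [|k IHk]; first by rewrite mulrC.
  have := hnorm_ge0 (iter k.+1 N x).
  rewrite le_eqVlt => /orP[/eqP <-|a0].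
    by rewrite mulr0 mulr_ge0 ?hnorm_ge0.
  rewrite -(ler_pM2r a0) -mulrA -expr2.
  apply: le_trans (ler_wpM2l (hnorm_ge0 _) (N_para (iter k N x))) _.
  rewrite mulrA [X in _ <= X]mulrAC; apply: ler_wpM2r IHk; exact: hnorm_ge0.
elim: n => [|n IHn]; first by rewrite expr0 mul1r expr1.
rewrite exprS; apply: le_trans (ler_wpM2l (hnorm_ge0 _) IHn) _.
by rewrite mulrCA exprSr -mulrA ler_wpM2l ?exprn_ge0 ?hnorm_ge0.
Qed.

Context (r C L : R).
Context (r_ge0 : 0 <= r) (C_ge0 : 0 <= C) (L_ge0 : 0 <= L).

(** F w stands for the inverse of 1 - w^n N^n; a left inverse suffices.  The
    constants C and L do not depend on n. *)
Definition inverse_family n F := forall w, cmod w <= r ->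
  [/\ forall x y, F w (x + y) = F w x + F w y,
      forall x, F w (x - w ^+ n *: iter n N x) = x,
      forall x, hnorm (F w x) <= C * hnorm x
    & forall w' x, cmod w' <= r ->
        hnorm (F w x - F w' x) <= L * cmod (w - w') * hnorm x].

(** With zeta^n = -1 and P = w^n N^n, the inverse of 1 - P^2 is the half-sum of
    the inverses of 1 - P and 1 + P, that is of F w and F (zeta w). *)
Lemma inverse_family_double n F : (0 < n)%N -> inverse_family n F ->
  exists F', inverse_family (n + n) F'.
Proof.
move=> n0 Fn; pose zeta : R[i] := n.-root (-1).
have zetaX : zeta ^+ n = -1 by rewrite rootCK.
have zeta1 : cmod zeta = 1.
  apply/eqP; rewrite -(pexpr_eq1 n0) ?cmod_ge0// -cmodX zetaX cmodN.
  by rewrite cmod1.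
have zw w : cmod w <= r -> cmod (zeta * w) <= r by rewrite cmodM zeta1 mul1r.
pose half : R[i] := (2^-1)%:C%C.
have half2 (x : H) : half *: (x + x) = x.
  have -> : x + x = 2 *: x by rewrite scaler_nat mulr2n.
  rewrite scalerA (_ : half * 2 = 1) ?scale1r//.
  by rewrite /half fmorphV/= (_ : 2%:C%C = 2) ?rmorph_nat// mulVf// pnatr_eq0.
have cmod_half : cmod half = 2^-1 by rewrite cmod_real// invr_ge0.
exists (fun w x => half *: (F w x + F (zeta * w) x)) => w wr.
have [FD FK FC FL] := Fn _ wr; have [GD GK GC GL] := Fn _ (zw _ wr).
split=> [x y|x|x|w' x w'r].
- by rewrite FD GD -scalerDr addrACA.
- pose y := w ^+ n *: iter n N x.
  have NN : w ^+ (n + n) *: iter (n + n) N x = w ^+ n *: iter n N y.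
    rewrite exprD iterD /y -scalerA; congr (_ *: _).
    have := iter_linear n (w ^+ n) (iter n N x) 0.
    have -> : iter n N 0 = 0.
      have := iter_linear n (-1) 0 0; rewrite scaler0 addr0 scaleN1r.
      by rewrite addNr.
    by rewrite !addr0 => ->.
  rewrite NN.
  have E1 : x - w ^+ n *: iter n N y = (x + y) - w ^+ n *: iter n N (x + y).
    have := iter_linear n 1 x y; rewrite !scale1r => ->.
    by rewrite scalerDr -/y opprD addrA addrK.
  have E2 : x - w ^+ n *: iter n N y
      = (x - y) - (zeta * w) ^+ n *: iter n N (x - y).
    have := iter_linear n (-1) y x; rewrite !scaleN1r (addrC _ x) => ->.
    by rewrite exprMn zetaX mulN1r scaleNr opprK scalerDr scalerN -/y
      [X in _ = _ + X]addrC addrA subrK.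
  by rewrite {1}E1 FK E2 GK addrACA subrr addr0 half2.
- rewrite hnorm_scale cmod_half.
  have := hnorm_triangle (F w x) (F (zeta * w) x).
  by have := FC x; have := GC x; lra.
- rewrite -scalerBr opprD addrACA hnorm_scale cmod_half.
  have := hnorm_triangle (F w x - F w' x) (F (zeta * w) x - F (zeta * w') x).
  have := FL _ x w'r; have := GL _ x (zw _ w'r).
  by rewrite -mulrBr cmodM zeta1 mul1r; lra.
Qed.

Lemma inverse_family_pow2 F : inverse_family 1 F ->
  forall k, exists F', inverse_family (2 ^ k) F'.
Proof.
move=> F1; elim=> [|k [F' IHk]]; first by exists F.
by rewrite expnS mul2n -addnn; apply: inverse_family_double IHk; rewrite expn_gt0.
Qed.

(** From t |N| <= 1 to t' |N| <= 1 for t' slightly larger than t.  At s = q t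
    with q < 1 the powers s^n N^n tend to 0, so the inverse of 1 - s^n N^n is
    within 1/8 of the identity for large n; the Lipschitz bound keeps the
    inverse of 1 - t'^n N^n within 1/4 of the identity.  Applying this to
    x - t'^n N^n x bounds t'^n |N^n x| by |x|, and logarithmic convexity turns
    this into a bound on t' |N x|. *)
Lemma lower_bound_step F t t' :
  (forall x, hnorm (N x) ^+ 2 <= hnorm x * hnorm (N (N x))) ->
  inverse_family 1 F ->
  0 <= t -> t <= t' -> t' <= r -> 16 * (L * (t' - t)) <= 1 ->
  (forall x, t * hnorm (N x) <= hnorm x) ->
  forall x, t' * hnorm (N x) <= hnorm x.
Proof.
move=> N_para F1 t0 tt' t'r Ltt' tN x.
have t'0 : 0 <= t' := le_trans t0 tt'.
have tr : t <= r := le_trans tt' t'r.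
have Lr1 : 0 < L * r + 1 by rewrite ltr_wpDl// mulr_ge0.
(* q is so close to 1 that L (t - q t) <= 1/16. *)
pose q := 1 - (16 * (L * r + 1))^-1.
have iq0 : 0 < (16 * (L * r + 1))^-1 by rewrite invr_gt0 mulr_gt0.
have iq1 : (16 * (L * r + 1))^-1 <= 1.
  by rewrite invf_le1 ?mulr_gt0//; have := mulr_ge0 L_ge0 r_ge0; lra.
have iqE : 16 * ((16 * (L * r + 1))^-1 * (L * r + 1)) = 1.
  by field; rewrite gt_eqF.
have q0 : 0 <= q by rewrite /q subr_ge0.
have q1 : q < 1 by rewrite /q; lra.
have Lq : 16 * (L * (t - q * t)) <= 1.
  have -> : t - q * t = (16 * (L * r + 1))^-1 * t by rewrite /q; ring.
  have := ler_wpM2l L_ge0 (ler_wpM2l (ltW iq0) tr); lra.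
have e80 : 0 < 1 / 8 :> R by [].
have [k Ck] := geometric_small q0 q1 C_ge0 e80.
have Cq : C * q ^+ (2 ^ k) <= 1 / 8.
  apply: le_trans (ltW Ck); rewrite ler_wpM2l//; apply: ler_wiXn2l => //.
    exact: ltW.
  by rewrite ltnW// ltn_expl.
have [G Gn] := inverse_family_pow2 F1 k.
set n := (2 ^ k)%N in Cq Gn.
pose s := q * t.
have s0 : 0 <= s by rewrite /s mulr_ge0.
have st : s <= t by rewrite /s ler_piMl// ltW.
have ws : cmod (s%:C%C : R[i]) <= r by rewrite cmod_real//; exact: le_trans tr.
have wt : cmod (t'%:C%C : R[i]) <= r by rewrite cmod_real.
have [GD GK GC GL] := Gn _ ws; have [_ GK' _ _] := Gn _ wt.
have near_id y : hnorm (G t'%:C%C y - y) <= 1 / 4 * hnorm y.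
  pose B := s%:C%C ^+ n *: iter n N y.
  have GsE : G s%:C%C y - y = G s%:C%C B.
    by rewrite -{1}(subrK B y) GD GK addrC addKr.
  have B_le : hnorm B <= q ^+ n * hnorm y.
    rewrite hnorm_scale cmodX cmod_real// /s exprMn -mulrA.
    by rewrite ler_wpM2l ?exprn_ge0//; exact: iter_bound.
  have h1 : hnorm (G s%:C%C y - y) <= 1 / 8 * hnorm y.
    rewrite GsE; apply: le_trans (GC _) _.
    apply: le_trans (ler_wpM2l C_ge0 B_le) _.
    by rewrite mulrA ler_wpM2r// hnorm_ge0.
  have h2 : hnorm (G s%:C%C y - G t'%:C%C y) <= 1 / 8 * hnorm y.
    apply: le_trans (GL _ _ wt) _; rewrite ler_wpM2r ?hnorm_ge0//.
    rewrite -rmorphB -cmodN -rmorphN cmod_real ?opprB ?subr_ge0 ?(le_trans st)//.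
    by move: Lq; rewrite -/s; lra.
  rewrite hnorm_distC in h2.
  have -> : G t'%:C%C y - y = (G t'%:C%C y - G s%:C%C y) + (G s%:C%C y - y).
    by rewrite addrA subrK.
  by apply: le_trans (hnorm_triangle _ _) _; lra.
have small : t' ^+ n * hnorm (iter n N x) <= hnorm x.
  pose A := t'%:C%C ^+ n *: iter n N x.
  have := near_id (x - A); rewrite GK' opprB addrC subrK.
  have -> : hnorm A = t' ^+ n * hnorm (iter n N x).
    by rewrite hnorm_scale cmodX cmod_real.
  have := hnorm_triangle x (- A); rewrite hnorm_opp.
  have -> : hnorm A = t' ^+ n * hnorm (iter n N x).
    by rewrite hnorm_scale cmodX cmod_real.
  by have := hnorm_ge0 x; lra.
have n0 : (0 < n)%N by rewrite expn_gt0.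
have := log_convex_iter N_para n.-1 x; rewrite prednK// => para.
rewrite -(ler_pXn2r n0) ?nnegrE ?mulr_ge0 ?hnorm_ge0// exprMn.
apply: le_trans (ler_wpM2l (exprn_ge0 n t'0) para) _.
have -> : hnorm x ^+ n = hnorm x ^+ n.-1 * hnorm x by rewrite -exprSr prednK.
by rewrite mulrCA ler_wpM2l ?exprn_ge0 ?hnorm_ge0.
Qed.

(** The admissible step length h in t depends only on L, so finitely many steps
    reach r. *)
Lemma paranormal_bound F :
  (forall x, hnorm (N x) ^+ 2 <= hnorm x * hnorm (N (N x))) ->
  inverse_family 1 F -> forall x, r * hnorm (N x) <= hnorm x.
Proof.
move=> N_para F1.
have L1 : 0 < L + 1 by rewrite ltr_wpDl.
pose h := (16 * (L + 1))^-1.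
have h0 : 0 < h by rewrite invr_gt0 mulr_gt0.
have hE : 16 * ((L + 1) * h) = 1 by rewrite /h; field; rewrite gt_eqF.
have main m : forall x, Num.min r (m%:R * h) * hnorm (N x) <= hnorm x.
  elim: m => [|m IHm] x.
    by rewrite mul0r (min_idPr r_ge0) mul0r hnorm_ge0.
  have mh0 : 0 <= m%:R * h by exact: mulr_ge0 (ler0n _ _) (ltW h0).
  have mS : m.+1%:R * h = m%:R * h + h by rewrite -natr1 mulrDl mul1r.
  have [ineq1 [ineq2 [ineq3 ineq4]]] :
      0 <= Num.min r (m%:R * h) /\ Num.min r (m%:R * h) <= Num.min r (m.+1%:R * h)
      /\ Num.min r (m.+1%:R * h) <= r /\
      Num.min r (m.+1%:R * h) - Num.min r (m%:R * h) <= h.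
    rewrite mS; have := r_ge0; move: mh0; set b := m%:R * h.
    by rewrite !minEle; case: ifP; case: ifP; lra.
  apply: (lower_bound_step N_para F1 ineq1 ineq2 ineq3) => //.
  have := ler_wpM2l L_ge0 ineq4; lra.
move=> x; have := main (Num.truncn (r / h)).+1 x.
rewrite (min_idPl _)// -ler_pdivrMr// ltW// truncnS_gt//.

Qed.

End SpectralRadius.

(** * Lower bounds on resolvent discs *)
Section ResolventLowerBounds.
Context {R : realType} {H : completeNormedModType R[i]}.
Implicit Types (x y : H) (w z : R[i]) (T : operator H).

Definition bounded_below T (m : R) :=
  forall x, op_dom T x -> m * hnorm x <= hnorm (T x).

Lemma resolvent_bounded_below T z : resolvent_set T z ->
  exists2 m : R, 0 < m & bounded_below (op_shift T z) m.
Proof.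
move=> [_ [G GK [K GB]]].
have K1 : 0 < `|K| + 1 by rewrite ltr_wpDl.
exists (`|K| + 1)^-1; first by rewrite invr_gt0.
move=> x Dx; rewrite mulrC ler_pdivrMr//.
have := GB (op_shift T z x); rewrite GK// => h; apply: le_trans h _.
rewrite mulrC ler_wpM2l ?hnorm_ge0//.
by apply: le_trans (ler_norm _) _; rewrite lerDl.
Qed.

Lemma bounded_below_shift T z w (m : R) :
  bounded_below (op_shift T z) m -> cmod (w - z) <= m / 2 ->
  bounded_below (op_shift T w) (m / 2).
Proof.
move=> mT wz x Dx; have := mT x Dx.
have -> : op_shift T z x = op_shift T w x + (w - z) *: x.
  by rewrite /= scalerBl addrA subrK.
move=> h; have := le_trans h (hnorm_triangle _ _); rewrite hnorm_scale => h'.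
have := ler_wpM2r (hnorm_ge0 x) wz; lra.
Qed.

(** A lower bound at one point persists on a neighbourhood, at half its value;
    compactness of the closed disc, as a subset of a square of R x R, makes it
    uniform. *)
Lemma uniform_bounded_below T z (r : R) :
  (forall w, cmod w <= r -> resolvent_set T (z + w)) ->
  exists2 m : R, 0 < m &
    forall w, cmod w <= r -> bounded_below (op_shift T (z + w)) m.
Proof.
move=> Tr.
pose K : set (R * R) := `[- r, r] `*` `[- r, r].
have cptK : compact K by apply: compact_setX; exact: segment_compact.
pose toC (p : R * R) : R[i] := Complex p.1 p.2.
pose P (m : R) p := cmod (toC p) <= r -> bounded_below (op_shift T (z + toC p)) m.
have ballE p (e : R) p' : ball p e p' -> cmod (toC p' - toC p) <= e + e.
  move=> [b1 b2]; apply: le_trans (cmod_le_ReIm _) _.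
  by rewrite /= distrC (distrC p'.2); exact: lerD (ltW b1) (ltW b2).
have cov : \forall m \near 0^'+, K `<=` P m.
  apply: (compact_near_coveringP K).1 => // p _.
  have [pr|pr] := leP (cmod (toC p)) r; last first.
    (* Outside the disc, the condition is vacuous on a neighbourhood. *)
    pose e := (cmod (toC p) - r) / 3.
    have e0 : 0 < e by rewrite divr_gt0// subr_gt0.
    exists (ball p e, setT); first by split; [exact: nbhsx_ballx|exact: filterT].
    move=> [p' m] [/= /ballE bp' _] p'r.
    have := cmodD (toC p') (- (toC p' - toC p)); rewrite cmodN opprB addrC subrK.
    by move: bp' p'r; rewrite /e; lra.
  have [m m0 mT] := resolvent_bounded_below (Tr _ pr).
  have m40 : 0 < m / 4 by rewrite divr_gt0.
  have m20 : 0 < m / 2 by rewrite divr_gt0.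
  exists (ball p (m / 4), [set i | i <= m / 2]).
    by split; [exact: nbhsx_ballx|exact: nbhs_right_le].
  move=> [p' i] [/= /ballE bp' im] _ x Dx.
  have pm2 : cmod (z + toC p' - (z + toC p)) <= m / 2.
    by rewrite opprD addrACA subrr add0r; lra.
  apply: le_trans (bounded_below_shift mT pm2 Dx).
  by rewrite ler_wpM2r// hnorm_ge0.
near (0 : R)^'+ => m.
exists m; first by [].
move=> w wr.
have Pm : K `<=` P m by near: m; exact: cov.
have wE : w = toC (complex.Re w, complex.Im w) by case: w {wr}.
rewrite {1}wE; apply: Pm; last by rewrite -wE.
have := cmod_sqr w; have := cmod_ge0 w; move: wr.
set c := cmod w; set a := complex.Re w; set b := complex.Im w => cr c0 cE.
have r0 : 0 <= r := le_trans c0 cr.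
have abr : c ^+ 2 <= r ^+ 2 by rewrite ler_sqr.
split; rewrite /= in_itv /= -ler_norml -ler_sqr ?nnegrE// real_normK ?num_real//.
  by have := sqr_ge0 b; lra.
by have := sqr_ge0 a; lra.
Unshelve. all: by end_near. Qed.

End ResolventLowerBounds.

Section NormalResolvent.
Context {R : realType} {H : completeNormedModType R[i]}.
Context (dot : {dot H for Num.conj}).
Context (dot_norm : forall x : H, dot x x = `|x| ^+ 2).
Implicit Types (x y : H) (w z : R[i]) (T : operator H).

(** Let S = T - z and N its inverse.  The resolvents G w of T at z + w provide
    the inverses F w = 1 + w G w = S G w of 1 - w N.  They are uniformly bounded
    by compactness, and Lipschitz in w by the resolvent identity
    G w - G w' = (w - w') G w G w'. *)
Lemma normal_bounded_below_closed_disc T z (r : R) : normal_operator dot T ->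
  0 <= r -> (forall w, cmod w <= r -> resolvent_set T (z + w)) ->
  bounded_below (op_shift T z) r.
Proof.
move=> T_normal r0 Tr; have [T_lin _ _ _] := T_normal.
have [m m0 mT] := uniform_bounded_below Tr.
have lin w := linear_operator_shift T_lin (z + w).
have inj w x y : cmod w <= r -> op_dom T x -> op_dom T y ->
    op_shift T (z + w) x = op_shift T (z + w) y -> x = y.
  move=> wr Dx Dy e; apply/eqP; rewrite -subr_eq0; apply/eqP/hnorm_le0_eq0.
  have := mT w wr _ (op_domB T_lin Dx Dy).
  by rewrite (opB (lin w) Dx Dy) e subrr hnorm0 pmulr_rle0.
have /choice[G0 G0P] : forall p : R[i] * H, exists x, cmod p.1 <= r ->
    op_dom T x /\ op_shift T (z + p.1) x = p.2.
  move=> [w y] /=; have [wr|wr] := leP (cmod w) r; last by exists 0.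
  have [[_ _ surj] _] := Tr _ wr; have [x Dx xy] := surj y I.
  by exists x.
pose G w y := G0 (w, y).
have GD w y : cmod w <= r -> op_dom T (G w y) by move=> wr; have [] := G0P (w, y) wr.
have GK w y : cmod w <= r -> op_shift T (z + w) (G w y) = y.
  by move=> wr; have [] := G0P (w, y) wr.
have G_uniq w x y : cmod w <= r -> op_dom T x -> op_shift T (z + w) x = y -> G w y = x.
  by move=> wr Dx xy; apply: (inj w) => //; [exact: GD|rewrite GK].
pose g := m^-1.
have g0 : 0 <= g by rewrite invr_ge0 ltW.
have Gg w y : cmod w <= r -> hnorm (G w y) <= g * hnorm y.
  move=> wr; rewrite /g mulrC ler_pdivlMr// mulrC -{2}(GK w y wr).
  exact: mT (GD w y wr).
have G_lin w (a : R[i]) x y : cmod w <= r -> G w (a *: x + y) = a *: G w x + G w y.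
  move=> wr; apply: G_uniq => //.
    by apply: (op_domD T_lin); [apply: (op_domZ T_lin)|]; exact: GD.
  have DGx := GD w x wr; have DGy := GD w y wr.
  rewrite (opD (lin w) (op_domZ T_lin a DGx) DGy) (opZ (lin w) a DGx).
  by rewrite !GK.
have shiftE w w' x : op_shift T (z + w) x = op_shift T (z + w') x + (w' - w) *: x.
  rewrite /= scalerBl !scalerDl !opprD -!addrA; congr (_ + (_ + _)).
  by rewrite addrA addNr add0r.
have zero_r : cmod (0 : R[i]) <= r by rewrite -[0]/(0%:C%C) cmod_real.
pose N := G 0.
have N_lin (a : R[i]) x y : N (a *: x + y) = a *: N x + N y by exact: G_lin.
have N_para x : hnorm (N x) ^+ 2 <= hnorm x * hnorm (N (N x)).
  have := normal_rdot_shift_le dot_norm z T_normal (GD 0 (N x) zero_r) (GD 0 x zero_r).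
  rewrite -[z]addr0 !GK// -(hnorm_sqr dot_norm) => h.
  by rewrite mulrC.
pose F w x := x + w *: G w x.
have FI : inverse_family N r (1 + r * g) (g + r * g ^+ 2) 1 F.
  move=> w wr; split=> [x y|x|x|w' x w'r]; rewrite /F.
  - have := G_lin w 1 x y wr; rewrite !scale1r => ->.
    by rewrite scalerDr addrACA.
  - rewrite expr1 /= (_ : G w _ = N x) ?subrK//.
    apply: G_uniq => //; first exact: GD.
    by rewrite (shiftE w 0) GK// sub0r scaleNr.
  - apply: le_trans (hnorm_triangle _ _) _; rewrite mulrDl mul1r lerD2l.
    by rewrite hnorm_scale -mulrA ler_pM ?cmod_ge0 ?hnorm_ge0// Gg.
  - have GG : G w x - G w' x = (w - w') *: G w (G w' x).
      have <- : G w ((w - w') *: G w' x) = (w - w') *: G w (G w' x).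
        have := G_lin w (w - w') (G w' x) 0 wr.
        rewrite addr0 (G_uniq w 0 0 wr (op_dom0 T_lin)) ?addr0//.
        exact: op0 (lin w).
      apply/esym/G_uniq => //; first by apply: (op_domB T_lin); exact: GD.
      rewrite (opB (lin w) (GD _ _ wr) (GD _ _ w'r)) GK// (shiftE w w') GK//.
      by rewrite opprD addrA subrr sub0r -scaleNr opprB.
    have -> : x + w *: G w x - (x + w' *: G w' x)
        = (w - w') *: G w x + w' *: ((w - w') *: G w (G w' x)).
      rewrite -GG scalerBr scalerBl opprD addrACA subrr add0r.
      by rewrite addrA subrK.
    apply: le_trans (hnorm_triangle _ _) _; rewrite !hnorm_scale.
    have c0 := cmod_ge0 (w - w').
    have h1 := ler_wpM2l c0 (Gg w x wr).
    have h2 : hnorm (G w (G w' x)) <= g * (g * hnorm x).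
      by apply: le_trans (Gg _ _ wr) _; rewrite ler_wpM2l// Gg.
    have h3 : cmod w' * (cmod (w - w') * hnorm (G w (G w' x)))
        <= r * (cmod (w - w') * (g * (g * hnorm x))).
      by rewrite ler_pM ?cmod_ge0 ?mulr_ge0 ?hnorm_ge0// ler_wpM2l.
    lra.
have C0 : 0 <= 1 + r * g by rewrite addr_ge0// mulr_ge0.
have L0 : 0 <= g + r * g ^+ 2 by rewrite addr_ge0// mulr_ge0// sqr_ge0.
move=> x Dx.
have := paranormal_bound N_lin r0 C0 L0 N_para FI (op_shift T z x).
by rewrite /N (G_uniq 0 x)// addr0.
Qed.

(** This is the bound of the resolvent norm of a normal operator by the inverse
    of the distance to the spectrum. *)
Lemma normal_bounded_below_disc T z (d : R) : normal_operator dot T ->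
  0 < d -> (forall w, cmod w < d -> resolvent_set T (z + w)) ->
  bounded_below (op_shift T z) d.
Proof.
move=> T_normal d0 Td x Dx; rewrite leNgt; apply/negP => lt_d.
have x0 : 0 < hnorm x.
  have := hnorm_ge0 x; rewrite le_eqVlt => /orP[/eqP x0|//].
  by move: lt_d; rewrite -x0 mulr0 ltNge hnorm_ge0.
pose r := hnorm (op_shift T z x) / hnorm x.
have rd : r < d by rewrite /r ltr_pdivrMr.
have r0 : 0 <= r by rewrite divr_ge0 ?hnorm_ge0.
have h : bounded_below (op_shift T z) ((r + d) / 2).
  apply: normal_bounded_below_closed_disc => //; first lra.
  by move=> w wr; apply: Td; lra.
have := h x Dx; rewrite -ler_pdivlMr// -/r; lra.
Qed.

End NormalResolvent.

(** * Relatively bounded perturbations *)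
Section Perturbation.
Context {R : realType} {H : completeNormedModType R[i]}.
Implicit Types (x y : H) (w z : R[i]) (T A : operator H).

Lemma linear_operator_perturb T A : linear_operator T -> linear_operator A ->
  op_dom T `<=` op_dom A -> linear_operator (op_perturb T A).
Proof.
move=> T_lin A_lin TA; split=> [|a x y Dx Dy|a x y Dx Dy] /=.
- exact: op_dom0 T_lin.
- exact: (op_domD T_lin (op_domZ T_lin a Dx) Dy).
- have [_ _ TE] := T_lin; have [_ _ AE] := A_lin.
  by rewrite (TE _ _ _ Dx Dy) (AE _ _ _ (TA _ Dx) (TA _ Dy)) scalerDr addrACA.
Qed.

(** With G the inverse of S = T - z, the map A G is Lipschitz with constant
    q < 1; solving (S + A) x = y amounts to finding the fixed point u = S x of
    u |-> y - A G u. *)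
Lemma resolvent_perturb T A z (q : R) :
  linear_operator T -> linear_operator A -> op_dom T `<=` op_dom A ->
  resolvent_set T z -> 0 <= q -> q < 1 ->
  (forall x, op_dom T x -> hnorm (A x) <= q * hnorm (op_shift T z x)) ->
  resolvent_set (op_perturb T A) z.
Proof.
move=> T_lin A_lin TA Tz q0 q1 Aq.
have [m m0 mT] := resolvent_bounded_below Tz.
pose B := op_shift (op_perturb T A) z.
have BE x : B x = op_shift T z x + A x by rewrite /B /= addrAC.
have B_lin : linear_operator B.
  by apply: linear_operator_shift; exact: linear_operator_perturb.
have q1' : 0 < 1 - q by rewrite subr_gt0.
have mB : bounded_below B ((1 - q) * m).
  move=> x Dx; have := hnorm_triangle (B x) (- A x).
  rewrite hnorm_opp BE addrK -BE => h1.
  have := ler_wpM2l (ltW q1') (mT x Dx); have := Aq x Dx; lra.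
have mB0 : 0 < (1 - q) * m by rewrite mulr_gt0.
have B_inj x y : op_dom T x -> op_dom T y -> B x = B y -> x = y.
  move=> Dx Dy e; apply/eqP; rewrite -subr_eq0; apply/eqP/hnorm_le0_eq0.
  have := mB _ (op_domB T_lin Dx Dy).
  by rewrite (opB B_lin Dx Dy) e subrr hnorm0 pmulr_rle0.
have [[_ _ surj] _] := Tz.
have /choice[G GP] : forall y, exists x, op_dom T x /\ op_shift T z x = y.
  by move=> y; have [x Dx xy] := surj y I; exists x.
have GD y : op_dom T (G y) := (GP y).1.
have GK y : op_shift T z (G y) = y := (GP y).2.
have S_lin := linear_operator_shift T_lin z.
have B_surj y : exists x, op_dom T x /\ B x = y.
  have phi_lip u v : hnorm ((y - A (G u)) - (y - A (G v))) <= q * hnorm (u - v).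
    have -> : (y - A (G u)) - (y - A (G v)) = A (G v - G u).
      rewrite (opB A_lin (TA _ (GD v)) (TA _ (GD u))).
      by rewrite opprB addrC addrA subrK.
    apply: le_trans (Aq _ (op_domB T_lin (GD v) (GD u))) _.
    by rewrite (opB S_lin (GD v) (GD u)) !GK hnorm_distC.
  have [u /= uE] := hnorm_fixed_point q0 q1 phi_lip.
  have BGu : B (G u) = y by rewrite BE GK -[X in X + _]uE subrK.
  by exists (G u).
split.
  split=> [x _ //|x y /set_mem Dx /set_mem Dy|y _]; first exact: B_inj.
  by have [x [Dx xy]] := B_surj y; exists x.
have /choice[G' G'P] := B_surj.
exists G' => [x Dx|]; first by have [D E] := G'P (B x); exact: B_inj.
exists ((1 - q) * m)^-1 => y; have [D {2}<-] := G'P y.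
by rewrite mulrC ler_pdivlMr// mulrC mB.
Qed.

(** Insert |x| <= |S x| / d and |T x| <= |S x| + |z| |x|; the exponents 1 - p and
    p of |S x| / d add up to 1. *)
Lemma interpolation_bound T A z (c p d : R) : 0 <= p -> p <= 1 -> 0 <= c ->
  0 < d -> bounded_below (op_shift T z) d ->
  (forall x, op_dom T x ->
     hnorm (A x) <= c * (hnorm x `^ (1 - p)) * (hnorm (T x) `^ p)) ->
  forall x, op_dom T x ->
    hnorm (A x) <= c * (d + cmod z) `^ p / d * hnorm (op_shift T z x).
Proof.
move=> p0 p1 c0 d0 dT Ac x Dx; apply: le_trans (Ac x Dx) _.
set s := hnorm (op_shift T z x).
have s0 : 0 <= s := hnorm_ge0 _.
have sd0 : 0 <= s / d by rewrite divr_ge0// ltW.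
have dz0 : 0 <= d + cmod z by rewrite addr_ge0 ?cmod_ge0 ?(ltW d0).
have xs : hnorm x <= s / d by rewrite ler_pdivlMr// mulrC; exact: dT.
have Txs : hnorm (T x) <= s / d * (d + cmod z).
  have -> : T x = op_shift T z x + z *: x by rewrite /= subrK.
  apply: le_trans (hnorm_triangle _ _) _; rewrite hnorm_scale -/s mulrDr.
  rewrite divfK ?gt_eqF// lerD2l mulrC ler_wpM2r ?cmod_ge0//.
have h1 : hnorm x `^ (1 - p) <= (s / d) `^ (1 - p).
  by rewrite ge0_ler_powR ?nnegrE ?hnorm_ge0// subr_ge0.
have h2 : hnorm (T x) `^ p <= (s / d * (d + cmod z)) `^ p.
  by rewrite ge0_ler_powR ?nnegrE ?hnorm_ge0// mulr_ge0.
have -> : c * (d + cmod z) `^ p / d * s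
    = c * ((s / d) `^ (1 - p) * (s / d * (d + cmod z)) `^ p).
  rewrite (powRM _ sd0 dz0) (mulrA (_ `^ (1 - p))) -powRD ?subrK ?oner_eq0// powRr1//.
  by field; rewrite gt_eqF.
rewrite -mulrA ler_wpM2l//; apply: ler_pM => //; exact: powR_ge0.
Qed.

End Perturbation.

(** * Distance to the parabolic regions *)
Section ParabolicRegions.
Context {R : realType}.
Implicit Types (z w : R[i]) (alpha beta d : R).

Definition bisectorial_region alpha beta : set R[i] :=
  parabolic_region beta `|` [set - z | z in parabolic_region (- alpha)].

Lemma strip_disc alpha beta z d :
  alpha + d < complex.Re z < beta - d ->
  forall w, cmod w < d -> ~ bisectorial_region alpha beta (z + w).
Proof.
move=> /andP[az zb] w wd.
have Re_w := le_lt_trans (Re_le_cmod w) wd.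
have := le_lt_trans (Re_le_cmod (- w)) (_ : cmod (- w) < d).
rewrite cmodN ReN => /(_ wd) Re_Nw.
case=> [[]|[y [ay _] yE]]; first by rewrite ReD; lra.
have := congr1 (@complex.Re R) yE; rewrite ReN ReD; lra.
Qed.

(** If the point z + w of a region is at abscissa t beyond the vertex, then
    |Re w| >= t and |Im w| >= nu - t^2 with nu = |Im z|.  If t^2 >= nu the real
    part suffices; otherwise use
    t^2 + (nu - t^2)^2 = nu - 1/4 + (t^2 - nu + 1/2)^2. *)
Lemma parabola_disc alpha beta z w :
  alpha < complex.Re z < beta ->
  bisectorial_region alpha beta (z + w) ->
  `|complex.Im z| - 1 / 4 <= cmod w ^+ 2.
Proof.
move=> /andP[az zb]; rewrite cmod_sqr.
have key (t a b : R) : 0 <= t -> t <= a -> `|complex.Im z| - t ^+ 2 <= b ->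
    `|complex.Im z| - 1 / 4 <= a ^+ 2 + b ^+ 2.
  move=> t0 ta tb; have ta2 : t ^+ 2 <= a ^+ 2 by rewrite ler_sqr ?nnegrE//; lra.
  have [tz|zt] := leP `|complex.Im z| (t ^+ 2); first by have := sqr_ge0 b; lra.
  have tb2 : (`|complex.Im z| - t ^+ 2) ^+ 2 <= b ^+ 2.
    by rewrite ler_sqr ?nnegrE//; lra.
  by have := sqr_ge0 (t ^+ 2 - `|complex.Im z| + 1 / 2); lra.
have Im_le : `|complex.Im z| - `|complex.Im (z + w)| <= `|complex.Im w|.
  have -> : complex.Im (z + w) = complex.Im z + complex.Im w by case: (z); case: (w).
  by have := ler_normB (complex.Im z + complex.Im w) (complex.Im w); rewrite addrK; lra.
rewrite -[complex.Im w ^+ 2]real_normK ?num_real//.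
case=> [[bz zw]|[y [ay ya] yE]].
  rewrite ReD in bz zw.
  by apply: (key (complex.Re z + complex.Re w - beta)); lra.
have ImE : `|complex.Im (z + w)| = `|complex.Im y|.
  by rewrite -yE; case: (y) => a b /=; rewrite normrN.
have ReE : complex.Re y = - (complex.Re z + complex.Re w).
  by rewrite -ReD -yE ReN opprK.
rewrite -[complex.Re w ^+ 2]sqrrN.
by apply: (key (complex.Re y - - alpha)); rewrite ReE in ay ya *; lra.
Qed.

Lemma cmod_le_strip alpha beta z (nu : R) :
  alpha <= complex.Re z <= beta -> `|complex.Im z| <= nu ->
  cmod z <= Num.sqrt (Num.max `|beta| `|alpha| ^+ 2 + nu ^+ 2).
Proof.
move=> /andP[az zb] znu; rewrite cmodE ler_wsqrtr//; apply: lerD.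
  have max0 : 0 <= Num.max `|beta| `|alpha| by rewrite le_max normr_ge0.
  rewrite -real_normK ?num_real// ler_sqr ?nnegrE// ler_norml.
  have := ler_norm beta; have := ler_norm (- alpha); rewrite normrN.
  have : `|beta| <= Num.max `|beta| `|alpha| by rewrite le_max lexx.
  have : `|alpha| <= Num.max `|beta| `|alpha| by rewrite le_max lexx orbT.
  by move=> *; apply/andP; split; lra.
by rewrite -real_normK ?num_real// ler_sqr ?nnegrE// (le_trans _ znu).
Qed.

End ParabolicRegions.

(** * Resolvent set of the perturbed operator *)

Unset Implicit Arguments.

Theorem proposition6p2 (R : realType) (H : completeNormedModType R[i])
    (dot : {dot H for Num.conj})
    (dot_norm : forall x : H, dot x x = `|x| ^+ 2)
    (T : operator H) (alphaT betaT : R)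
    (T_normal : normal_operator dot T)
    (alpha_lt_beta : alphaT < betaT)
    (spectrum_T : spectrum T `<=`
       parabolic_region betaT `|` [set - z | z in parabolic_region (- alphaT)])
    (p c : R) (p_ge0 : 0 <= p) (p_lt : p < 1 / 2) (c_gt0 : 0 < c)
    (A : operator H) (A_linear : linear_operator A)
    (dom_TA : op_dom T `<=` op_dom A)
    (A_bound : forall x, op_dom T x ->
       hnorm (A x) <= c * (hnorm x `^ (1 - p)) * (hnorm (T x) `^ p))
    (nu0 : R) :
  let zetaT := Num.max `|betaT| `|alphaT| in
  1 / 2 <= nu0 ->
  (forall nu : R, nu0 < nu ->
     c * ((Num.sqrt (nu - 1 / 4) + Num.sqrt (zetaT ^+ 2 + nu ^+ 2)) `^ p)
       / Num.sqrt (nu - 1 / 4) < 1) ->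
  forall M : R,
  0 < M ->
  c * ((M + Num.sqrt (zetaT ^+ 2 + nu0 ^+ 2)) `^ p) / M < 1 ->
  2 * M < betaT - alphaT ->
  [set z : R[i] | alphaT + M < complex.Re z < betaT - M]
    `<=` resolvent_set (op_perturb T A).
Proof.
move=> zetaT nu0_ge nu_lt1 M M0 M_lt1 _ z /= zM.
have [T_lin _ _ _] := T_normal.
have z_strip : alphaT < complex.Re z < betaT by case/andP: zM => *; apply/andP; lra.
have z_strip' : alphaT <= complex.Re z <= betaT by case/andP: zM => *; apply/andP; lra.
(* The smallness condition only has to be checked for an upper bound rho of the
   modulus of z. *)
have disc (d rho : R) : 0 < d -> cmod z <= rho -> c * (d + rho) `^ p / d < 1 ->
    (forall w, cmod w < d -> ~ bisectorial_region alphaT betaT (z + w)) ->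
    resolvent_set (op_perturb T A) z.
  move=> d0 z_rho small away.
  have Tw w : cmod w < d -> resolvent_set T (z + w).
    by move=> wd; apply: contrapT => /spectrum_T; exact: away.
  have Tz : resolvent_set T z by rewrite -[z]addr0; apply: Tw; rewrite (@cmod_real _ 0).
  have dT := normal_bounded_below_disc dot_norm T_normal d0 Tw.
  have p1 : p <= 1 by lra.
  have A_rel := interpolation_bound p_ge0 p1 (ltW c_gt0) d0 dT A_bound.
  apply: resolvent_perturb A_rel => //.
    by rewrite divr_ge0 ?mulr_ge0 ?powR_ge0// ltW.
  apply: le_lt_trans small; rewrite ler_pM2r ?invr_gt0// ler_pM2l//.
  have z0 := cmod_ge0 z.
  by apply: ge0_ler_powR; rewrite ?nnegrE//; lra.
have [z_low|z_high] := leP `|complex.Im z| nu0.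
  apply: (disc M (Num.sqrt (zetaT ^+ 2 + nu0 ^+ 2))) => //.
    exact: cmod_le_strip.
  exact: strip_disc.
have nu_gt : 0 < `|complex.Im z| - 1 / 4 by lra.
apply: (disc (Num.sqrt (`|complex.Im z| - 1 / 4))
             (Num.sqrt (zetaT ^+ 2 + `|complex.Im z| ^+ 2))).
- by rewrite sqrtr_gt0.
- exact: cmod_le_strip.
- exact: nu_lt1.
- move=> w wd /(parabola_disc z_strip); apply/negP; rewrite -ltNge.
  by rewrite -(sqr_sqrtr (ltW nu_gt)) ltr_sqr ?nnegrE ?cmod_ge0 ?sqrtr_ge0.
Qed.
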